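(* For every integer $d\ge 2$, $q_{d+1}<q_d$, where $q_d=\inf\{p\in(0,1/2) : M^{d,p}<1\}$.
   Context: For an integer $d\ge 2$ and $p\in(0,1/2)$ set $$p_d^*=\frac{p(d-1)}{d-(d+1)p},\qquad \hat p=\frac{p}{1-p}.$$ For $\lambda\ge 0$ the random variable $U=U(d,p,\lambda)\in\{0,1,\dots,d-1\}$ is defined by the following particle process. Consider the star graph with central vertex $\varnothing'$ joined to a vertex $\varnothing$ (the root) and to leaves $v_1,\dots,v_d$. Initially there is a $\mathrm{Poisson}(1)$ number of active particles at $\varnothing'$, an independent $\mathrm{Poisson}(\lambda)$ number of active particles at $v_1$, and independent $\mathrm{Poisson}(\lambda)$ numbers of dormant particles at each of $v_2,\dots,v_d$. Each particle started at $\varnothing'$ independently moves to $\varnothing$ with probability $p_d^*$ and otherwise moves to a uniformly sampled vertex among $v_1,\dots,v_d$. Each particle started at $v_i$, once active, independently moves to $\varnothing'$ with probability $1$, and then moves to $\varnothing$ with probability $\hat p$ and otherwise to a uniformly sampled vertex of $\{v_1,\dots,v_d\}\setminus\{v_i\}$. Whenever an active particle moves to a vertex containing dormant particles, these become active. When a particle moves to a leaf or to $\varnothing$ it remains frozen there forever. $U(d,p,\lambda)$ is the number of vertices among $v_2,\dots,v_d$ that have been visited once all particles are either frozen or dormant. Define $$M^{d,p}=\sup_{\lambda\ge 0}\mathbf E\big[e^{\lambda-p_d^*-\hat p\,(1+U(d,p,\lambda))\lambda}\big]\in[0,\infty].$$ *)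

(* Defs.v *)
From HB Require Import structures.
From mathcomp Require Import all_boot all_order all_algebra.
From mathcomp Require Import all_classical all_reals all_analysis.

Set Implicit Arguments.
Unset Strict Implicit.
Unset Printing Implicit Defensive.

Import Order.TTheory GRing.Theory Num.Theory.

Local Open Scope classical_set_scope.
Local Open Scope ring_scope.

(* Vertices of the star: the leaves v_1, ..., v_d are the elements of 'I_d,
   v_1 being the one of value 0. As the starting vertex of a particle,
   [None] : option 'I_d is the centre; as the vertex where a particle ends up,
   [None] is the root. *)

Definition is_v1 (d : nat) (i : 'I_d) : bool := val i == 0%N.

Definition counts (d : nat) := {ffun option 'I_d -> nat}.

Definition particle (d : nat) (n : counts d) : finType :=
  {s : option 'I_d & 'I_(n s)}.

(* A realization of all the randomness: the number of particles started at each
   vertex, and for each particle the vertex to which it goes when it jumps away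
   from the centre. This jump is the only random move of a particle; it is drawn
   also for the particles which never become active. *)
Definition outcome (d : nat) :=
  {n : counts d & {ffun particle n -> option 'I_d}}.

Section Dynamics.
Variables (d : nat) (n : counts d) (dest : {ffun particle n -> option 'I_d}).

Inductive pstate :=
  | Dormant of 'I_d
  | Active_leaf of 'I_d
  | Active_centre
  | Frozen of option 'I_d.

Definition active (s : pstate) : bool :=
  match s with Active_leaf _ | Active_centre => true | _ => false end.

Record config := Config {
  state : particle n -> pstate;
  visited : {set 'I_d}
}.

Definition init_state (x : particle n) : pstate :=
  match tag x with
  | None => Active_centre
  | Some i => if is_v1 i then Active_leaf i else Dormant i
  end.

Definition init : config := Config init_state finset.set0.

Definition jumping (c : config) (x : particle n) : bool :=
  if state c x is Active_centre then true else false.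

Definition arrivals (c : config) : {set 'I_d} :=
  [set j | [exists x, jumping c x && (dest x == Some j)]]%SET.

(* All the active particles move simultaneously. The order of the moves has no
   influence on the final set of visited leaves, since the route of a particle
   does not depend on when it is activated. *)
Definition step (c : config) : config :=
  Config
    (fun x => match state c x with
      | Dormant i => if i \in arrivals c then Active_leaf i else Dormant i
      | Active_leaf _ => Active_centre
      | Active_centre => Frozen (dest x)
      | Frozen v => Frozen v
      end)
    (visited c :|: arrivals c)%SET.

(* A particle moves at most twice and, as long as some particle is active, each
   step moves at least one; hence the number of steps (see [final_halted]). *)
Definition final : config := iter (2 * #|{: particle n}|)%N step init.

Let rank (s : pstate) : nat :=
  match s with Dormant _ | Active_leaf _ => 2 | Active_centre => 1
             | Frozen _ => 0 end.

Let trank (c : config) : nat := (\sum_x rank (state c x))%N.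

Let rank_step c x :
  (active (state c x) + rank (state (step c) x) <= rank (state c x))%N.
Proof. by rewrite /=; case: (state c x) => //= i; case: ifP. Qed.

Let active_step c x : active (state (step c) x) ->
  exists y, active (state c y).
Proof.
rewrite /=; case E: (state c x) => [i|i||v] //=.
- case: ifP => // + _; rewrite inE => /existsP[y /andP[Hy _]].
  by exists y; move: Hy; rewrite /jumping; case: (state c y).
- by exists x; rewrite E.
Qed.

Let iter_rank k x : active (state (iter k step init) x) ->
  (k + trank (iter k step init) <= 2 * #|{: particle n}|)%N.
Proof.
elim: k x => [|k IHk] x.
  move=> _; rewrite add0n mulnC -sum_nat_const; apply: leq_sum => y _.
  by case: (state _ y).
rewrite iterS => /active_step[y ay]; apply: leq_trans (IHk y ay).
rewrite addSnnS leq_add2l /trank (bigD1 y)//= [leqRHS](bigD1 y)//= -addSn.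
apply: leq_add; first by move: (rank_step (iter k step init) y); rewrite ay.
apply: leq_sum => z _; apply: leq_trans (rank_step _ z); exact: leq_addl.
Qed.

Lemma final_halted x : ~~ active (state final x).
Proof.
apply/negP => ax; have := iter_rank ax.
rewrite -/final -[leqRHS]addn0 leq_add2l leqn0 /trank sum_nat_eq0.
by move=> /forallP/(_ x) /=; case: (state final x) ax.
Qed.

Definition num_visited : nat :=
  #|[set i | (i \in visited final) && ~~ is_v1 i]%SET|.

End Dynamics.

Definition U (d : nat) (w : outcome d) : nat := num_visited (tagged w).

Section Law.
Variables (R : realType) (d : nat) (p : R).

Definition p_star : R := p * (d%:R - 1) / (d%:R - (d%:R + 1) * p).

Definition p_hat : R := p / (1 - p).

(* Unlike [poisson_pmf], this is the Dirac mass at 0 when [rate = 0]. *)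
Definition poisson_mass (rate : R) (k : nat) : R :=
  rate ^+ k / k`!%:R * expR (- rate).

Definition start_rate (lambda : R) (s : option 'I_d) : R :=
  if s is Some _ then lambda else 1.

(* The probability that a particle started at [s] jumps from the centre
   to [t]. *)
Definition jump_prob (s t : option 'I_d) : R :=
  match s, t with
  | None, None => p_star
  | None, Some _ => (1 - p_star) / d%:R
  | Some _, None => p_hat
  | Some i, Some j => if j == i then 0 else (1 - p_hat) / (d%:R - 1)
  end.

Definition outcome_prob (lambda : R) (w : outcome d) : R :=
  (\prod_(s : option 'I_d) poisson_mass (start_rate lambda s) (tag w s)) *
  (\prod_(x : particle (tag w)) jump_prob (tag x) (tagged w x)).

(* The expectation of a nonnegative function on the countable space
   [outcome d]. *)
Definition expect (lambda : R) (f : outcome d -> R) : \bar R :=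
  \esum_(w in [set: outcome d]) (outcome_prob lambda w * f w)%:E.

Definition M : \bar R :=
  ereal_sup [set expect lambda
      (fun w => expR (lambda - p_star - p_hat * (1 + (U w)%:R) * lambda))
    | lambda in [set lambda : R | 0 <= lambda]].

End Law.

Definition q (R : realType) (d : nat) : \bar R :=
  ereal_inf [set p%:E | p in [set p : R | 0 < p < 2^-1 /\ (M d p < 1)%E]].

(* Main.v *)
(* By Poisson thinning, whether leaf [i] sends a particle to leaf [j] are
   independent events, so [U] is the final size of a Reed-Frost epidemic among
   the [n = d - 1] leaves other than [v_1]: each is exposed to a pressure [b]
   from the centre and [v_1], and every visited leaf adds a pressure [rho] on
   each of the others. In terms of [E n x b], the expectation of
   [x ^ (final size)], the defining recursion of the final size distribution
   amounts to the differential equation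
   [E n x ' (b) = n * (x * E (n - 1) x (b + rho) - E n x b)], [E n x 0 = 1].
   A Gronwall argument then shows that spreading the same total pressure over
   one more leaf decreases [E]. Since moreover [p_star] increases with [d],
   the expectation defining [M] decreases by a factor bounded away from [1],
   uniformly in [lambda]. This leaves room to decrease [p] a little below
   [q_d]: for [lambda] bounded the loss is a factor close to [1], and for
   [lambda] large the expectation is close to the contribution of [U = 0],
   which is at most [exp (-1/2)], because [M d p < 1] forces
   [p / (1 - 2 p) >= 1 / (d - 1)]. *)
From HB Require Import structures.
Require Import Defs.
From mathcomp Require Import all_boot all_order all_algebra.
From mathcomp Require Import all_classical all_reals all_analysis.
From mathcomp Require Import ring lra zify.

Set Implicit Arguments.
Unset Strict Implicit.
Unset Printing Implicit Defensive.

Import Order.TTheory GRing.Theory Num.Theory.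
Import numFieldNormedType.Exports.

Local Open Scope ring_scope.

(** * The final size of a Reed-Frost epidemic *)

(** The product [expR (a * z) * h z] has a nonnegative derivative for [z >= 0], so it stays above
    its value at [0]. *)
Lemma gronwall_ge0 (R : realType) (h dh : R -> R) (a : R) :
  (forall z : R, is_derive z (1 : R) h (dh z)) ->
  (forall z : R, 0 <= z -> - a * h z <= dh z) ->
  0 <= h 0 -> forall z : R, 0 <= z -> 0 <= h z.
Proof.
move=> hd hle h0 z z0.
pose g := (fun t : R => expR (a * t)) * h.
have gd (t : R) : is_derive t (1 : R) g (expR (a * t) * (dh t + a * h t)).
  apply: is_derive_eq; rewrite /GRing.scale /= !mulr1; ring.
suff : g 0 <= g z.
  have gE (t : R) : g t = expR (a * t) * h t by [].
  rewrite !gE mulr0 expR0 mul1r => /(le_trans h0).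
  by rewrite pmulr_rge0 ?expR_gt0.
have gc (t : R) : {for t, continuous g}.
  by apply: differentiable_continuous; apply/derivable1_diffP; case: (gd t).
apply: (@ger0_derive1_ndecr R g 0 z) => // [t|].
- rewrite in_itv /= => /andP[t0 _].
  rewrite derive1E; case: (gd t) => _ ->.
  rewrite mulr_ge0 ?expR_ge0//; have := hle t (ltW t0); lra.
- exact: continuous_subspaceT.
Qed.

Section Gontcharoff.
Variables (R : realType) (rho : R).
Implicit Types (b x : R) (k m n : nat).

(* The probability that [k] given infected individuals and the external
   pressure [b] infect none of the [n - k] others. *)
Definition escape n k b : R := expR (- ((n - k)%:R * (b + k%:R * rho))).

(* The probability that all of [m] individuals are infected; [N] is fuel for
   the course-of-values recursion [fullE] on [m]. The final size of the epidemic
   among [n] individuals is [k] with probability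
   ['C(n, k) * escape n k b * full k b]. *)
Fixpoint full_fuel N m b : R :=
  if N is N'.+1 then
    1 - \sum_(k < m) 'C(m, k)%:R * escape m k b * full_fuel N' k b
  else 0.

Definition full m := full_fuel m.+1 m.

Lemma full_fuel_indep N N' m b : (m < N)%N -> (m < N')%N ->
  full_fuel N m b = full_fuel N' m b.
Proof.
elim: N N' m => [//|N IH] [//|N'] m mN mN' /=.
congr (1 - _); apply: eq_bigr => k _; congr (_ * _).
by apply: IH; apply: leq_trans (ltn_ord k) _.
Qed.

Lemma fullE m b :
  full m b = 1 - \sum_(k < m) 'C(m, k)%:R * escape m k b * full k b.
Proof.
rewrite {1}/full /=; congr (1 - _); apply: eq_bigr => k _; congr (_ * _).
by apply: full_fuel_indep.
Qed.

(* Partial sums of the probability generating function, of which [epgf] is the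
   whole; by [fullE], [full m] is [1] minus a partial sum at [x = 1]. *)
Definition gpart j n x b : R :=
  \sum_(k < j) 'C(n, k)%:R * x ^+ k * escape n k b * full k b.

Lemma is_derive_escape n k b :
  is_derive b (1 : R) (escape n k) (- (n - k)%:R * escape n k b).
Proof.
rewrite /escape; apply: is_derive_eq.
rewrite /GRing.scale /=; ring.
Qed.

(** One infected individual leaves the population and its pressure [rho] is counted as external
    instead. *)
Lemma escape_shift n k b : escape n k.+1 b = escape n.-1 k (b + rho).
Proof.
rewrite /escape -natr1; have -> : (n - k.+1 = n.-1 - k)%N by lia.
by congr expR; ring.
Qed.

Lemma is_derive_shift (g dg : R -> R) (a : R) :
  (forall b : R, is_derive b (1 : R) g (dg b)) ->
  forall b : R, is_derive b (1 : R) (fun t => g (t + a)) (dg (b + a)).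
Proof.
move=> gd b; have := gd (b + a) => h.
have -> : (fun t => g (t + a)) = g \o (fun t => t + a) by [].
apply: is_derive_eq.
by rewrite /GRing.scale /=; ring.
Qed.

(** The hypothesis is limited to [k < j] because [is_derive_full] uses the case [j = m] inside a
    strong induction. In the product rule the coefficients [n - k] and [k] add up to [n]; the
    remaining sum is reindexed by [k * 'C(n, k) = n * 'C(n - 1, k - 1)]. *)
Lemma is_derive_gpart j n x b :
  (forall k b, (k < j)%N -> is_derive b (1 : R) (full k)
     (k%:R * (full k.-1 (b + rho) - full k b))) ->
  (j <= n.+1)%N ->
  is_derive b (1 : R) (gpart j n x)
    (n%:R * (x * gpart j.-1 n.-1 x (b + rho) - gpart j n x b)).
Proof.
move=> fd jn.
have gE : gpart j n x = \sum_(k < j)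
    (fun b => ('C(n, k)%:R * x ^+ k) *: (escape n k b * full k b)).
  apply/funext => t; rewrite /gpart fct_sumE; apply: eq_bigr => k _.
  by rewrite /GRing.scale /= !mulrA.
rewrite [X in is_derive _ _ X _]gE.
have hd (k : 'I_j) := fd k b (ltn_ord k).
have he k := is_derive_escape n k b.
apply: is_derive_eq.
rewrite mulrBr (eq_bigr (fun i : 'I_j =>
  (i%:R * 'C(n, i)%:R) * x ^+ i * escape n i b * full i.-1 (b + rho)
  - n%:R * ('C(n, i)%:R * x ^+ i * escape n i b * full i b))); last first.
  move=> i _; rewrite /GRing.scale /=.
  have -> : n%:R = (n - i)%:R + i%:R :> R.
    by rewrite -natrD subnK// -ltnS (leq_trans (ltn_ord i)).
  by ring.
rewrite sumrB -mulr_sumr; congr (_ - _).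
rewrite {}/gpart; case: j {fd jn gE hd} => [|j].
  by rewrite !big_ord0 !mulr0.
rewrite big_ord_recl /= !mul0r add0r !mulr_sumr; apply: eq_bigr => i _.
rewrite /bump /= !add1n escape_shift -natrM -mul_bin_diag natrM exprS; ring.
Qed.

(** The probabilities of all final sizes add up to [1]: this is [fullE] with its left side taken as
    the term [k = n]. *)
Lemma gpart_full n b : gpart n.+1 n 1 b = 1.
Proof.
rewrite /gpart big_ord_recr /= [X in _ + X]mulrC fullE binn expr1n.
rewrite /escape subnn mul0r oppr0 expR0 !mulr1 addrC.
by rewrite -[RHS](subrK (\sum_(k < n) 'C(n, k)%:R * escape n k b * full k b));
  congr (_ + _); apply: eq_bigr => k _; rewrite expr1n mulr1.
Qed.

Lemma is_derive_full m b : is_derive b (1 : R) (full m)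
  (m%:R * (full m.-1 (b + rho) - full m b)).
Proof.
elim/ltn_ind: m b => m IH b.
have fE : full m = cst 1 - gpart m m 1.
  apply/funext => t; rewrite fullE; congr (1 - _).
  by apply: eq_bigr => k _; rewrite expr1n mulr1.
have := @is_derive_gpart m m 1 b (fun k t km => IH k km t) (leqnSn _).
move=> dg; rewrite [X in is_derive _ _ X _]fE; apply: is_derive_eq.
rewrite sub0r -mulrN; case: m {IH dg} fE => [|m] fE; first by rewrite !mul0r.
have -> : full m.+1 b = 1 - gpart m.+1 m.+1 1 b by rewrite fE.
congr (_ * _); have := gpart_full m (b + rho).
rewrite {1}/gpart big_ord_recr /= -/(gpart m m 1 (b + rho)).
by rewrite binn expr1n /escape subnn mul0r oppr0 expR0 !mul1r => h; lra.
Qed.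

Definition epgf n x b : R := gpart n.+1 n x b.

Lemma is_derive_epgf n x b : is_derive b (1 : R) (epgf n x)
  (n%:R * (x * epgf n.-1 x (b + rho) - epgf n x b)).
Proof.
have := @is_derive_gpart n.+1 n x b (fun k t _ => is_derive_full k t) (leqnn _).
by case: n => [|n]; rewrite /epgf //= !mul0r.
Qed.

Lemma full_0 b : full 0 b = 1.
Proof. by rewrite fullE big_ord0 subr0. Qed.

Lemma escape00 n : escape n 0 0 = 1.
Proof. by rewrite /escape mul0r addr0 mulr0 oppr0 expR0. Qed.

(** Without external pressure nobody is infected: in [fullE] the term [k = 0] is already [1], and
    the others vanish by induction. *)
Lemma fullS0 m : full m.+1 0 = 0.
Proof.
elim/ltn_ind: m => m IH; rewrite fullE big_ord_recl big1 => [|i _] /=.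
  by rewrite full_0 escape00 bin0 !mulr1 addr0 subrr.
by rewrite /bump /= add1n IH ?mulr0.
Qed.

Lemma epgf0 n x : epgf n x 0 = 1.
Proof.
rewrite /epgf /gpart big_ord_recl big1 => [|i _] /=.
  by rewrite full_0 escape00 bin0 expr0 !mulr1 addr0.
by rewrite /bump /= add1n fullS0 mulr0.
Qed.

Lemma epgf_0 x b : epgf 0 x b = 1.
Proof.
by rewrite /epgf /gpart big_ord1 /= full_0 /escape mul0r oppr0 expR0 bin0 !mulr1.
Qed.

Hypothesis rho0 : 0 <= rho.

(** The sign is not visible in the subtractive recursion [fullE]; it comes from the differential
    equation, by induction on [m]. *)
Lemma full_ge0 m b : 0 <= b -> 0 <= full m b.
Proof.
elim: m b => [|m IH] b; first by rewrite full_0.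
apply: (gronwall_ge0 (a := m.+1%:R) (is_derive_full m.+1)) => [z z0|].
  rewrite -subr_ge0 [leRHS](_ : _ = m.+1%:R * full m (z + rho)); last by ring.
  by rewrite mulr_ge0// IH ?addr_ge0.
by rewrite fullS0.
Qed.

Lemma full_le1 m b : 0 <= b -> full m b <= 1.
Proof.
move=> b0; rewrite fullE gerBl sumr_ge0// => k _.
by rewrite mulr_ge0 ?full_ge0// mulr_ge0 ?expR_ge0.
Qed.

Section pgf_argument.
Variable x : R.
Hypotheses (x0 : 0 <= x) (x1 : x <= 1).

Lemma epgf_ge0 n b : 0 <= b -> 0 <= epgf n x b.
Proof.
move=> b0; rewrite /epgf /gpart sumr_ge0// => k _.
by rewrite !mulr_ge0 ?full_ge0 ?expR_ge0 ?exprn_ge0.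
Qed.

(** The hypothesis is [epgf_infect_le] at [n], left as an assumption because the induction proving
    that lemma needs monotonicity at [n] to reach [n.+1]. *)
Let epgf_mono n b b' : (forall t, 0 <= t -> x * epgf n.-1 x (t + rho) <= epgf n x t) ->
  0 <= b -> b <= b' -> epgf n x b' <= epgf n x b.
Proof.
move=> h b0 bb'.
have cE (t : R) : {for t, continuous (epgf n x)}.
  apply: differentiable_continuous; apply/derivable1_diffP.
  by case: (is_derive_epgf n x t).
apply: (@ler0_derive1_nincr R (epgf n x) 0 b') => // [t _|t|].
- by case: (is_derive_epgf n x t).
- rewrite in_itv /= => /andP[t0 _].
  rewrite derive1E; case: (is_derive_epgf n x t) => _ ->.
  by rewrite mulr_ge0_le0// subr_le0 h// ltW.
- exact: continuous_subspaceT.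
Qed.

(** Infecting one individual at the outset can only lower the generating function. The difference
    [h] of the two sides satisfies [h' = - (n + 1) * h] plus a nonnegative multiple of the same
    difference for one individual fewer. *)
Lemma epgf_infect_le n b : 0 <= b -> x * epgf n.-1 x (b + rho) <= epgf n x b.
Proof.
elim: n b => [|n IH] b b0; first by rewrite !epgf_0 mulr1.
rewrite -subr_ge0.
have dE := is_derive_shift rho (@is_derive_epgf n x).
apply: (gronwall_ge0 (a := n.+1%:R)
  (h := fun t => epgf n.+1 x t - x * epgf n x (t + rho)) _ _ _ b0) => [z|z z0|].
- have d1 := is_derive_epgf n.+1 x z; have d2 := dE z.
  have -> : (fun t => epgf n.+1 x t - x * epgf n x (t + rho)) =
     (epgf n.+1 x - (x *: (fun t => epgf n x (t + rho)))) by [].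
  apply: is_derive_eq; reflexivity.
- rewrite /GRing.scale /=.
  rewrite -subr_ge0 [leRHS](_ : _ = x * (n%:R *
    (epgf n x (z + rho) - x * epgf n.-1 x (z + rho + rho)))); last by ring.
  by rewrite !mulr_ge0// subr_ge0 IH// addr_ge0.
- rewrite add0r epgf0 subr_ge0 (le_trans _ x1)// ler_piMr//.
  by rewrite -(epgf0 n x) epgf_mono.
Qed.

Lemma epgf_nincr n b b' : 0 <= b -> b <= b' -> epgf n x b' <= epgf n x b.
Proof. by apply: epgf_mono => t t0; exact: epgf_infect_le. Qed.

Lemma epgf_le1 n b : 0 <= b -> epgf n x b <= 1.
Proof. by move=> b0; rewrite -(epgf0 n x) epgf_nincr. Qed.

Lemma epgf_ge_expn n b : 0 <= b -> x ^+ n <= epgf n x b.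
Proof.
move=> b0; rewrite -[leLHS]mulr1 -(gpart_full n b) /epgf /gpart mulr_sumr.
apply: ler_sum => k _; rewrite expr1n !mulr1 !mulrA ler_wpM2r ?full_ge0//.
rewrite ler_wpM2r ?expR_ge0// mulrC ler_wpM2l// ler_wiXn2l//.
by rewrite -ltnS.
Qed.

Lemma epgf_scale n b y : 0 <= b -> 1 <= y ->
  epgf n (y * x) b <= y ^+ n * epgf n x b.
Proof.
move=> b0 y1; rewrite /epgf /gpart mulr_sumr; apply: ler_sum => k _.
rewrite !mulrA ler_wpM2r ?full_ge0// ler_wpM2r ?expR_ge0// exprMn mulrCA mulrA.
rewrite -!mulrA ler_wpM2r ?mulr_ge0 ?exprn_ge0// ler_weXn2l//.
by rewrite -ltnS.
Qed.

End pgf_argument.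
End Gontcharoff.

(* The total pressures [z] and [r] are divided evenly among [n] or [n + 1]
   individuals, of whom all but [m], resp. [m + 1], are already infected. *)
Lemma epgf_compare (R : realType) (x r : R) (n m : nat) (z : R) :
  0 <= x -> x <= 1 -> 0 <= r -> (0 < n)%N -> (m <= n)%N -> 0 <= z ->
  epgf (r / n.+1%:R) m.+1 x (z / n.+1%:R) <= epgf (r / n%:R) m x (z / n%:R).
Proof.
move=> x0 x1 r0 n0; elim: m z => [|m IH] z mn z0.
  by rewrite epgf_0 epgf_le1 ?divr_ge0.
rewrite -subr_ge0.
pose E k j (t : R) := epgf (r / k%:R) j x (t / k%:R).
have dE k j (t : R) : (0 < k)%N -> is_derive t (1 : R) (E k j)
    (j%:R / k%:R * (x * E k j.-1 (t + r) - E k j t)).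
  move=> k0.
  have -> : E k j = epgf (r / k%:R) j x \o (fun t => t * k%:R^-1) by [].
  have d1 := is_derive_epgf (r / k%:R) j x (t / k%:R).
  apply: is_derive_eq; rewrite /E /GRing.scale /= mulrDl; ring.
have d1 (t : R) := dE n m.+1 t n0.
have d2 (t : R) := dE n.+1 m.+2 t isT.
have hd (t : R) : is_derive t (1 : R) (E n m.+1 - E n.+1 m.+2)
  (m.+1%:R / n%:R * (x * E n m (t + r) - E n m.+1 t) -
   m.+2%:R / n.+1%:R * (x * E n.+1 m.+1 (t + r) - E n.+1 m.+2 t)).
  by apply: is_derive_eq.
(* With [q = (m + 1) / n] and [q' = (m + 2) / (n + 1)], the derivative plus [q] times the difference
   is the sum of the two products shown nonnegative below. *)
apply: (gronwall_ge0 (a := m.+1%:R / n%:R) hd) z0 => [t t0|].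
- rewrite [(_ - _) t](_ : _ = E n m.+1 t - E n.+1 m.+2 t)//=.
  have IHt : E n.+1 m.+1 (t + r) <= E n m (t + r).
    exact: IH (ltnW mn) (addr_ge0 t0 r0).
  have inf : x * E n.+1 m.+1 (t + r) <= E n.+1 m.+2 t.
    rewrite /E mulrDl; apply: (epgf_infect_le _ x0 x1 m.+2); exact: divr_ge0.
  (* Clearing denominators leaves [m + 1 <= n]. *)
  have quot : m.+1%:R / n%:R <= m.+2%:R / n.+1%:R :> R.
    by rewrite ler_pdivrMr ?ltr0n// mulrAC ler_pdivlMr ?ltr0n// -!natrM ler_nat; lia.
  have q0 : 0 <= m.+1%:R / n%:R :> R by rewrite divr_ge0.
  move: quot q0; set q := _ / _; set q' := _ / _ => quot q0.
  have : 0 <= (q' - q) * (E n.+1 m.+2 t - x * E n.+1 m.+1 (t + r)).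
    by rewrite mulr_ge0 ?subr_ge0.
  have : 0 <= q * (x * (E n m (t + r) - E n.+1 m.+1 (t + r))).
    by rewrite !mulr_ge0 ?subr_ge0.
  nra.
- by rewrite [(_ - _) 0](_ : _ = E n m.+1 0 - E n.+1 m.+2 0)//= /E !mul0r !epgf0 subrr.
Qed.

(** * Visited leaves as reachable leaves *)

Section Reachability.
Variable d : nat.
Implicit Types (B W X Y : {set 'I_d}) (E : {set option 'I_d * 'I_d}).

(** Particles at the centre and at [v_1] are active from the start, so both count as sources for
    every [X]. *)
Definition sources X : {set option 'I_d} :=
  [set s | if s is Some i then is_v1 i || (i \in X) else true]%SET.

Definition block X Y : {set option 'I_d * 'I_d} := finset.setX (sources X) Y.

Definition hits W E X : {set 'I_d} :=
  [set j in W | [exists s in sources X, (s, j) \in E]]%SET.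

Definition reach W E : {set 'I_d} := fixset (hits W E).

Lemma sources_mono X Y : X \subset Y -> sources X \subset sources Y.
Proof.
move=> XY; apply/fintype.subsetP => -[i|]; rewrite !inE // => /orP[->//|iX].
by rewrite (fintype.subsetP XY) ?orbT.
Qed.

Lemma hits_mono W W' E X Y : W \subset W' -> X \subset Y ->
  hits W E X \subset hits W' E Y.
Proof.
move=> WW' XY; apply/fintype.subsetP => j; rewrite !inE => /andP[jW].
rewrite (fintype.subsetP WW') //= => /exists_inP[s sX sE].
by apply/exists_inP; exists s => //; apply: fintype.subsetP sX; exact: sources_mono.
Qed.

Lemma hits_sub W E X : hits W E X \subset W.
Proof. by apply/fintype.subsetP => j; rewrite inE => /andP[]. Qed.

Lemma reachK W E : hits W E (reach W E) = reach W E.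
Proof. by apply: fixsetK => X Y; exact: hits_mono. Qed.

Lemma reach_sub W E : reach W E \subset W.
Proof. by rewrite -reachK hits_sub. Qed.

Lemma reach_min W E X : hits W E X \subset X -> reach W E \subset X.
Proof.
move=> hX; rewrite /reach /fixset; elim: #|_| => [|k IH] /=; first exact: finset.sub0set.
exact: fintype.subset_trans (hits_mono _ _ IH) hX.
Qed.

Lemma disjoint_blockP X Y E :
  reflect (forall s j, s \in sources X -> j \in Y -> (s, j) \notin E)
    [disjoint E & block X Y].
Proof.
rewrite disjoint_sym disjoint_subset; apply: (iffP fintype.subsetP) => [h s j sX jY|h [s j]].
  by have := h (s, j); rewrite finset.in_setX /= sX jY; apply.
by rewrite finset.in_setX => /andP[sX jY]; exact: h.
Qed.

(** The first event depends only on the edges into [B], the second only on edges into [W :\: B].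
    These are disjoint sets of edges, which is what makes the probability factor. *)
Lemma reach_eq B W E : B \subset W ->
  (reach W E == B) = (reach B E == B) && [disjoint E & block B (W :\: B)%SET].
Proof.
move=> BW; apply/eqP/andP => [<-|[/eqP BB /disjoint_blockP dis]].
  split.
    rewrite finset.eqEsubset reach_sub /=; apply: reach_min.
    have sub : reach (reach W E) E \subset reach W E by exact: reach_sub.
    apply/fintype.subsetP => j jh; rewrite -reachK inE.
    have jr : j \in reach W E.
      by rewrite -reachK; apply: fintype.subsetP jh; apply: hits_mono.
    by rewrite jr; move: jh; rewrite inE => /andP[].
  apply/disjoint_blockP => s j sX; rewrite !inE => /andP[jN jW].
  apply: contra jN => sj; rewrite -reachK inE jW.
  by apply/exists_inP; exists s.
apply/eqP; rewrite finset.eqEsubset; apply/andP; split.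
  apply: reach_min; apply/fintype.subsetP => j; rewrite inE => /andP[jW /exists_inP[s sB sj]].
  apply/negPn/negP => jB.
  by have := dis s j sB; rewrite !inE jB jW => /(_ isT); rewrite sj.
rewrite -{1}BB; apply: reach_min.
by rewrite -{2}(reachK W); apply: hits_mono.
Qed.

End Reachability.

(** Particles that never become active contribute too, so the edge set is read off the outcome
    without running the dynamics. *)
Definition edges (d : nat) (w : outcome d) : {set option 'I_d * 'I_d} :=
  [set e | [exists x : particle (tag w), (tag x == e.1) && (tagged w x == Some e.2)]]%SET.

Definition other_leaves (d : nat) : {set 'I_d} := [set i | ~~ is_v1 i]%SET.

(** * Invariants of the particle dynamics *)

Section Final.
Variables (d : nat) (n : counts d) (dest : {ffun particle n -> option 'I_d}).

Let E : {set option 'I_d * 'I_d} := edges (existT _ n dest).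
Let V := reach (other_leaves d) E.

(** The first two clauses confine the visited leaves to [V]. The last three, once no particle is
    active, make the visited set closed under [hits], so that it contains the least closed set
    [V]. *)
Let config_ok (c : config n) : Prop :=
  [/\ forall i, i \in visited c -> ~~ is_v1 i -> i \in V,
      forall x, (if state c x is Dormant i then tag x == Some i
                 else tag x \in sources V),
      forall x, (if state c x is Frozen v then v == dest x else true),
      forall x, (if state c x is Frozen (Some j) then j \in visited c else true) &
      forall x, tag x \in sources (visited c) ->
         (if state c x is Dormant i then false else true)].

Let init_ok : config_ok (init n).
Proof.
split=> [i|x|x|x|x] /=; rewrite /init_state ?finset.in_set0 //.
- by case: x => -[i|] k //=; [case: ifP => vi //=; rewrite inE vi|rewrite inE].
- by case: (tag x) => [i|] //; case: ifP.
- by case: (tag x) => [i|] //; case: ifP.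
- by rewrite inE; case: (tag x) => [i|] //; rewrite finset.in_set0 orbF => ->.
Qed.

Let step_ok c : config_ok c -> config_ok (step dest c).
Proof.
case=> hV hdorm hfr hvis hact.
have arrV j : j \in arrivals dest c -> ~~ is_v1 j -> j \in V.
  rewrite inE => /existsP[x /andP[]]; rewrite /jumping.
  have := hdorm x; case: (state c x) => // xV _ /eqP dx vj.
  rewrite /V -reachK inE inE vj /=; apply/exists_inP; exists (tag x) => //.
  by rewrite inE /=; apply/existsP; exists x; rewrite eqxx dx eqxx.
split=> /= [i|x|x|x|x].
- by rewrite finset.in_setU => /orP[/hV|/arrV].
- have := hdorm x; case: (state c x) => //= i /eqP xi.
  case: ifP => [iarr|_]; last by rewrite xi.
  by rewrite xi inE; case: (boolP (is_v1 i)) => //= vi; exact: arrV.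
- have := hfr x; case: (state c x) => //= i; case: ifP => //.
- have := hvis x; case sx: (state c x) => [i|i||v] //=; first by case: ifP.
    move=> _; case dx: (dest x) => [j|] //; rewrite finset.in_setU; apply/orP; right.
    by rewrite inE; apply/existsP; exists x; rewrite /jumping sx dx /=.
  by case: v {sx} => // j jv; rewrite finset.in_setU jv.
- have := hact x; have := hdorm x; case sx: (state c x) => [i|i||v] //= /eqP xi h.
  case: ifP => // iarr; rewrite xi inE finset.in_setU iarr orbF.
  by move: h; rewrite xi inE => h /h.
Qed.

Lemma visited_final : [set i | (i \in visited (final dest)) && ~~ is_v1 i]%SET = V.
Proof.
have : config_ok (final dest).
  rewrite /final; elim: (2 * _)%N => [|k IH]; first exact: init_ok.
  by rewrite iterS; exact: step_ok.
case=> hV hdorm hfr hvis hact; apply/eqP; rewrite finset.eqEsubset; apply/andP; split.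
  by apply/fintype.subsetP => i; rewrite inE => /andP[]; exact: hV.
apply: reach_min; apply/fintype.subsetP => j; rewrite inE => /andP[jV].
case/exists_inP => s sV; rewrite [in X in X -> _]inE /= => /existsP[x /andP[/eqP xs /eqP dx]].
rewrite !inE in jV *; rewrite jV andbT.
have := final_halted dest x; have := hact x; have := hfr x; have := hvis x.
have -> : tag x \in sources (visited (final dest)).
  rewrite xs; apply: fintype.subsetP sV; apply: sources_mono.
  by apply/fintype.subsetP => i; rewrite inE => /andP[].
case: (state _ x) => //= [i _ _ /(_ isT)//|v + /eqP vd _ _].
by rewrite vd dx.
Qed.
End Final.

Lemma U_reach d (w : outcome d) : U w = #|reach (other_leaves d) (edges w)|.
Proof. by case: w => n dest; rewrite /U /num_visited visited_final. Qed.

(** * Probability that no particle uses a given set of edges *)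

Section Exhaustion.
Local Open Scope classical_set_scope.

(** The lists need not be nested: every finite set lies in [B K] for all large [K], which bounds the
    sum above by [l], and each [B K] is itself a finite set, which bounds it below. *)
Lemma esum_exhaustion (R : realType) (T : choiceType) (a : T -> R)
    (B : nat -> seq T) (l : R) :
  (forall x, 0 <= a x) -> (forall K, uniq (B K)) ->
  (forall x, \forall K \near \oo, x \in B K) ->
  (fun K => \sum_(x <- B K) a x) @ \oo --> l ->
  \esum_(x in [set: T]) (a x)%:E = l%:E.
Proof.
move=> a0 uB exB cvl.
have sumB K : \sum_(x \in [set` B K]) (a x)%:E = (\sum_(x <- B K) a x)%:E.
  by rewrite -fsbig_seq// sumEFin.
apply/eqP; rewrite eq_le; apply/andP; split.
  apply: ge_ereal_sup => _ [F [finF _] <-].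
  have FB : \forall K \near \oo, F `<=` [set` B K].
    have [r ->] : exists r : seq T, F = [set` r] by case/finite_seqP: finF => r; exists r.
    elim: r {finF} => [|x r IH]; first by near=> K => y.
    near=> K => y /=; rewrite inE => /orP[/eqP->|yr].
      by near: K; exact: exB.
    by apply: (near IH K).
  rewrite fsumEFin// lee_fin; apply: (cvgr_to_ge cvl); near=> K.
  rewrite -lee_fin -fsumEFin// -sumB; apply: lee_fsum_nneg_subset => //.
    by move=> y; rewrite !inE /=; apply: (near FB K).
  by move=> y _; rewrite lee_fin.
have ub K : ((\sum_(x <- B K) a x)%:E <= \esum_(x in [set: T]) (a x)%:E)%E.
  by rewrite -sumB; apply: ereal_sup_ubound; exists [set` B K] => //; split.
case: (\esum_(x in _) _) ub => [r ub|_|/(_ 0%N)//].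
  by rewrite lee_fin; apply: (cvgr_to_le cvl); apply: nearW => K; rewrite -lee_fin.
by rewrite leey.
Unshelve. all: by end_near. Qed.

End Exhaustion.

Lemma sum_option (R : nmodType) (T : finType) (F : option T -> R) :
  \sum_t F t = F None + \sum_j F (Some j).
Proof.
rewrite (bigD1 None) //=; congr (_ + _).
rewrite (reindex_omap Some id) => [|[j|]] //=.
by apply: eq_bigl => j; rewrite eqxx.
Qed.

Section Avoidance.
Variables (R : realType) (d : nat) (p lambda : R).
Local Notation site := (option 'I_d).
Implicit Types (A : {set site * 'I_d}) (s t : site).

(** By Poisson thinning, the number of particles started at [e.1] that jump to [e.2] is Poisson with
    this mean; [theta A] is then the probability that no edge of [A] is used. *)
Definition edge_rate (e : site * 'I_d) : R :=
  start_rate lambda e.1 * jump_prob p e.1 (Some e.2).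

Definition theta A : R := expR (- \sum_(e in A) edge_rate e).

Definition allowed A s t : bool := if t is Some j then (s, j) \notin A else true.

Lemma disjoint_edges A (w : outcome d) :
  [disjoint edges w & A] = [forall x : particle (tag w), allowed A (tag x) (tagged w x)].
Proof.
rewrite disjoint_subset; apply/fintype.subsetP/forallP => [h x|h [s j]].
  rewrite /allowed; case E: (tagged w x) => [j|] //.
  apply: h; rewrite !inE /=; apply/existsP; exists x.
  by rewrite E !eqxx.
rewrite inE /= => /existsP[x /andP[/eqP <- /eqP xj]].
by have := h x; rewrite xj.
Qed.

Definition allowed_mass A s : R := \sum_t jump_prob p s t * (allowed A s t)%:R.

Lemma sum_dest A (n : counts d) :
  \sum_(dest : {ffun particle n -> site})
    (\prod_(x : particle n) jump_prob p (tag x) (dest x)) *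
    [forall x : particle n, allowed A (tag x) (dest x)]%:R =
  \prod_s allowed_mass A s ^+ n s.
Proof.
transitivity (\prod_(x : particle n) allowed_mass A (tag x)).
  rewrite /allowed_mass bigA_distr_bigA; apply: eq_bigr => dest _.
  rewrite big_split /=; congr (_ * _).
  case: (boolP [forall x : particle n, _]) => [/forallP h|/forallPn[x /negbTE h]].
    by rewrite big1// => x _; rewrite h.
  by rewrite (bigD1 x)//= h mul0r.
rewrite -(sig_big_dep (J := fun s => 'I_(n s)) xpredT (fun s _ => true)
  (fun s _ => allowed_mass A s)) /=.
by apply: eq_bigr => s _; rewrite prodr_const card_ord.
Qed.

Definition counts_of K (m : {ffun site -> 'I_K.+1}) : counts d :=
  [ffun s => nat_of_ord (m s)].

(** Capping the number of particles at each site separately makes the sum over a box factor over the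
    sites, see [sum_box]. *)
Definition box (K : nat) : seq (outcome d) :=
  [seq existT (fun n : counts d => {ffun particle n -> site}) n dest |
     n <- [seq counts_of m | m <- enum {: {ffun site -> 'I_K.+1}}],
     dest <- enum {: {ffun particle n -> site}}].

Lemma box_uniq K : uniq (box K).
Proof.
apply: allpairs_uniq_dep => [|n _|]; last by move=> [n f] [m g] _ _ /=.
- rewrite map_inj_uniq ?enum_uniq// => m m' /ffunP mm'; apply/ffunP => s.
  by apply: val_inj; have := mm' s; rewrite !ffunE.
- exact: enum_uniq.
Qed.

Lemma mem_box K (w : outcome d) : (forall s, tag w s <= K)%N -> w \in box K.
Proof.
case: w => n dest /= nK; apply: allpairs_f_dep; last by rewrite mem_enum.
apply/mapP; exists [ffun s => inord (n s)]; first by rewrite mem_enum.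
by apply/ffunP => s; rewrite !ffunE inordK// ltnS.
Qed.

Lemma sum_box K (A : {set site * 'I_d}) :
  \sum_(w <- box K) outcome_prob p lambda w * [disjoint edges w & A]%:R =
  \prod_s \sum_(k < K.+1) poisson_mass (start_rate lambda s) k * allowed_mass A s ^+ k.
Proof.
rewrite big_allpairs_dep big_map big_enum bigA_distr_bigA; apply: eq_bigr => m _.
rewrite big_enum /= big_split /=.
under eq_bigr do rewrite disjoint_edges /outcome_prob /= -mulrA.
rewrite -mulr_sumr sum_dest; congr (_ * _); apply: eq_bigr => s _; rewrite ffunE//.
Qed.

Lemma poisson_gf_cvg (r y : R) :
  ((fun K => \sum_(k < K.+1) poisson_mass r k * y ^+ k) @ \oo -->
    expR (- (r * (1 - y))))%classic.
Proof.
have -> : (fun K => \sum_(k < K.+1) poisson_mass r k * y ^+ k) =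
    (fun K => expR (- r) * series (exp_coeff (r * y)) K.+1).
  apply/funext => K; rewrite /series /= big_mkord mulr_sumr; apply: eq_bigr => k _.
  by rewrite /poisson_mass /exp_coeff /= exprMn; ring.
have -> : expR (- (r * (1 - y))) = expR (- r) * expR (r * y).
  by rewrite -expRD; congr expR; ring.
apply: cvgM; first exact: cvg_cst.
rewrite (cvg_shiftS (series (exp_coeff (r * y)))).
exact: is_cvg_series_exp_coeff.
Qed.

Hypotheses (p0 : 0 < p) (p12 : p < 2^-1) (d2 : (2 <= d)%N).

Lemma p_star_ge0 : 0 <= p_star d p.
Proof.
have dR : 2 <= d%:R :> R by rewrite ler_nat.
by apply: divr_ge0; move: p0 p12; nra.
Qed.

Lemma p_star_le1 : p_star d p <= 1.
Proof.
have dR : 2 <= d%:R :> R by rewrite ler_nat.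
by rewrite /p_star ler_pdivrMr; move: p0 p12; nra.
Qed.

Lemma p_hat_ge0 : 0 <= p_hat p.
Proof. by apply: divr_ge0; [exact: ltW | move: p12; lra]. Qed.

Lemma p_hat_le1 : p_hat p <= 1.
Proof. by rewrite /p_hat ler_pdivrMr; move: p0 p12; lra. Qed.

Lemma jump_prob_ge0 s t : 0 <= jump_prob p s t.
Proof.
have dR : 2%:R <= d%:R :> R by rewrite ler_nat.
case: s t => [i|] [j|] /=; rewrite ?p_hat_ge0 ?p_star_ge0//; last first.
  by rewrite divr_ge0 ?subr_ge0 ?p_star_le1//; lra.
by case: ifP => // _; rewrite divr_ge0 ?subr_ge0 ?p_hat_le1//; lra.
Qed.

Lemma sum_jump_prob s : \sum_t jump_prob p s t = 1.
Proof.
have dR : 2 <= d%:R :> R by rewrite ler_nat.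
rewrite sum_option; case: s => [i|] /=; last first.
  by rewrite sumr_const card_ord -mulr_natr; field; lra.
rewrite (bigD1 i)//= eqxx add0r (eq_bigr (fun=> (1 - p_hat p) / (d%:R - 1))).
  have -> : d%:R - 1 = d.-1%:R :> R by rewrite -subn1 natrB//; lia.
  rewrite sumr_const cardC1 card_ord -[X in _ + X]mulr_natr mulfVK ?subrKC//.
  by rewrite pnatr_eq0; lia.
by move=> j /negbTE ->.
Qed.

Lemma outcome_prob_ge0 (w : outcome d) : 0 <= lambda -> 0 <= outcome_prob p lambda w.
Proof.
move=> l0; rewrite mulr_ge0// prodr_ge0// => [s _|x _]; last exact: jump_prob_ge0.
rewrite /poisson_mass !mulr_ge0 ?expR_ge0 ?invr_ge0 ?exprn_ge0//.
by case: s.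
Qed.

(** Over [box K] the sum is a product over the starting sites, whose factors converge to the Poisson
    generating function at [allowed_mass A s]; [1 - allowed_mass A s] collects the jump
    probabilities along [A]. *)
Lemma expect_avoid A (c : R) : 0 <= lambda -> 0 <= c ->
  expect p lambda (fun w => c * [disjoint edges w & A]%:R) = (c * theta A)%:E.
Proof.
move=> l0 c0; apply: (esum_exhaustion (B := box)) => [w|K|w|].
- by rewrite mulr_ge0 ?outcome_prob_ge0// mulr_ge0.
- exact: box_uniq.
- exists (\max_s tag w s)%N => //= K hK; apply: mem_box => s.
  exact: leq_trans (leq_bigmax s) hK.
have -> : theta A = \prod_s expR (- (start_rate lambda s * (1 - allowed_mass A s))).
  rewrite /theta -expR_sum; congr expR; rewrite sumrN; congr (- _).
  rewrite big_mkcond (eq_bigr (fun e =>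
    if (e.1, e.2) \in A then edge_rate (e.1, e.2) else 0)) => [|[]//].
  rewrite -(pair_bigA _ (fun s j =>
    if (s, j) \in A then edge_rate (s, j) else 0)) /=.
  apply: eq_bigr => s _; rewrite -[1](sum_jump_prob s) /allowed_mass -sumrB.
  rewrite sum_option /= mulr1 subrr add0r mulr_sumr; apply: eq_bigr => j _.
  by rewrite /edge_rate /=; case: ifP => _; rewrite ?mulr0 ?mulr1 ?subr0 ?subrr ?mulr0.
have sumE K : \sum_(w <- box K) outcome_prob p lambda w * (c * [disjoint edges w & A]%:R) =
    c * \prod_s \sum_(k < K.+1) poisson_mass (start_rate lambda s) k * allowed_mass A s ^+ k.
  by rewrite -sum_box mulr_sumr; apply: eq_bigr => w _; rewrite mulrCA.
under eq_fun do rewrite sumE.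
apply: cvgM; first exact: cvg_cst.
apply: cvg_big => [|s _]; first by move=> x; exact: mul_continuous.
exact: poisson_gf_cvg.
Qed.

End Avoidance.

(** * The law of U *)

Lemma sum_powerset_card (V : nmodType) (T : finType) (B : {set T}) (G : nat -> V) :
  \sum_(X in powerset B) G #|X| = \sum_(k < #|B|.+1) G k *+ 'C(#|B|, k).
Proof.
rewrite (partition_big (fun X : {set T} => inord #|X| : 'I_(#|B|.+1)) xpredT) //=.
apply: eq_bigr => k _; rewrite -(cards_draws B k) -sumr_const; apply: eq_big => [X|X].
  rewrite powersetE inE; case: (boolP (X \subset B)) => //= XB.
  by rewrite -val_eqE /= inordK// ltnS subset_leq_card.
by case/andP => XB /eqP <-; rewrite inordK// ltnS subset_leq_card -?powersetE.
Qed.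

Section LawOfU.
Variables (R : realType) (d : nat) (p lambda : R).
Hypotheses (p0 : 0 < p) (p12 : p < 2^-1) (d2 : (2 <= d)%N) (l0 : 0 <= lambda).
Local Notation site := (option 'I_d).
Implicit Types (A : {set site * 'I_d}) (B Y : {set 'I_d}).

(** [leaf_rate] and [first_rate] are the pressures [rho] and [b] of the epidemic. *)
Definition leaf_rate : R := lambda * ((1 - p_hat p) / (d%:R - 1)).
Definition first_rate : R := (1 - p_star d p) / d%:R + leaf_rate.

Local Notation theta := (theta p lambda).
Local Notation "'E_' f" := (expect p lambda f) (at level 10, f at level 8).

(** Each leaf of [Y] receives [first_rate] from the centre and [v_1] together and [leaf_rate] from
    each leaf of [B]; disjointness excludes edges from a leaf to itself, whose rate is [0]. *)
Lemma theta_block B Y : B \subset other_leaves d -> Y \subset other_leaves d ->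
  [disjoint B & Y] ->
  theta (block B Y) = expR (- (#|Y|%:R * (first_rate + #|B|%:R * leaf_rate))).
Proof.
move=> BO YO BY; rewrite /theta; congr expR; congr (- _).
transitivity (\sum_(j in Y) \sum_(s in sources B) edge_rate p lambda (s, j)).
  rewrite exchange_big /= pair_big_dep /=; apply: eq_big => [[s j]|[s j] _] //=.
  by rewrite /block finset.in_setX.
rewrite mulr_natl -sumr_const; apply: eq_bigr => j jY.
rewrite big_mkcond sum_option /= ifT; last by rewrite inE.
rewrite {1}/edge_rate /= mul1r /first_rate -addrA; congr (_ + _).
pose v1 : 'I_d := Ordinal (ltnW d2).
have v1P i : is_v1 i = (i == v1) by rewrite /is_v1 -val_eqE.
rewrite -big_mkcond /= (eq_bigr (fun=> leaf_rate)).
  rewrite sumr_const [X in _ *+ X](_ : _ = #|v1 |: B|).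
    rewrite cardsU1 (_ : v1 \notin B) ?mulrS ?mulr_natl//.
    by apply/negP => /(fintype.subsetP BO); rewrite inE v1P eqxx.
  by apply: fintype.eq_card => i; rewrite [LHS]inE !inE -v1P.
move=> i iB; rewrite /edge_rate /=.
case: eqP => // ji; move: iB; rewrite -ji inE /= => /orP[vj|jB].
  by have := fintype.subsetP YO _ jY; rewrite inE vj.
by have := disjointFr BY jB; rewrite jY.
Qed.

Lemma thetaU A A' : [disjoint A & A'] -> theta (A :|: A')%SET = theta A * theta A'.
Proof.
move=> AA'; rewrite /theta -expRD -opprD; congr expR; congr (- _).
by rewrite -bigU//; apply: eq_bigl => e; rewrite !inE.
Qed.

Lemma expect_sum (I : finType) (P : pred I) (f : I -> outcome d -> R) :
  (forall i w, P i -> 0 <= f i w) ->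
  E_ (fun w => \sum_(i | P i) f i w) = (\sum_(i | P i) E_ (f i))%E.
Proof.
move=> f0; rewrite /expect -esum_sum => [|w i _ Pi].
  by apply: eq_esum => w _; rewrite mulr_sumr sumEFin.
by rewrite lee_fin mulr_ge0 ?f0 ?outcome_prob_ge0.
Qed.

Lemma disjoint_setU A A' (F : {set site * 'I_d}) :
  [disjoint F & A :|: A'] = [disjoint F & A] && [disjoint F & A'].
Proof. by rewrite -!setI_eq0 finset.setIUr finset.setU_eq0. Qed.

(* Conditioning on the leaves reached within [B] expresses the probability that
   all of [B] is reached by the same recursion [fullE] as [full]. The set [A]
   stands for the edges which the induction requires to be unused. *)
Lemma expect_reach B A (c : R) : B \subset other_leaves d ->
  [disjoint A & block B B] -> 0 <= c ->
  E_ (fun w => c * ((reach B (edges w) == B) && [disjoint edges w & A])%:R) =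
  (c * (full leaf_rate #|B| first_rate * theta A))%:E.
Proof.
move: {2}#|B|.+1 (ltnSn #|B|) => m; elim: m B A => // m IH B A Bm BO AB c0.
pose C (X : {set 'I_d}) := block X (B :\: X)%SET.
have subB (X : {set 'I_d}) : X \in powerset B -> X \subset B by rewrite powersetE.
have CA (X : {set 'I_d}) : X \subset B -> [disjoint A & C X].
  move=> XB; apply: disjointWr AB; apply/fintype.subsetP => -[s j].
  rewrite !finset.in_setX => /andP[sX]; rewrite finset.in_setD => /andP[_ ->].
  by rewrite andbT; apply: fintype.subsetP sX; exact: sources_mono.
have thetaC (X : {set 'I_d}) : X \subset B -> theta (A :|: C X)%SET =
    theta A * escape leaf_rate #|B| #|X| first_rate.
  move=> XB; rewrite thetaU ?CA// theta_block//.
  - by rewrite cardsD (finset.setIidPr XB).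
  - exact: fintype.subset_trans BO.
  - exact: fintype.subset_trans (finset.subsetDl _ _) BO.
  - by rewrite -setI_eq0 finset.setIDA finset.setDIl finset.setDv finset.set0I.
(* Decompose by the set [X] reached within [B]. For [X] other than [B] the induction applies, with
   the edges [C X] added to [A]. *)
have split_avoid w : c * [disjoint edges w & A]%:R = \sum_(X in powerset B)
    c * ((reach X (edges w) == X) && [disjoint edges w & (A :|: C X)%SET])%:R.
  rewrite (bigD1 (reach B (edges w))) ?powersetE ?reach_sub//= big1 => [|X].
    by rewrite addr0 disjoint_setU andbCA -reach_eq ?reach_sub// eqxx andbT.
  case/andP => /subB XB XN; rewrite disjoint_setU andbCA -reach_eq//.
  by rewrite eq_sym (negbTE XN) andbF mulr0.
have := expect_avoid p0 p12 d2 A l0 c0.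
under [X in expect p lambda X]eq_fun do rewrite split_avoid.
rewrite expect_sum => [|X w _]; last by rewrite mulr_ge0.
have total : c * theta A = \sum_(X in powerset B)
    c * (theta A * escape leaf_rate #|B| #|X| first_rate * full leaf_rate #|X| first_rate).
  have := sum_powerset_card B (fun k => c * (theta A *
    escape leaf_rate #|B| k first_rate * full leaf_rate k first_rate)).
  move=> ->; rewrite -[LHS]mulr1 -(gpart_full leaf_rate #|B| first_rate) mulr_sumr.
  by apply: eq_bigr => k _; rewrite expr1n -[RHS]mulr_natr; ring.
rewrite {}total (bigD1 B) ?powersetE//= [in RHS](bigD1 B) ?powersetE//= EFinD.
have -> : (A :|: C B)%SET = A.
  apply/finset.setP => -[s j]; rewrite finset.in_setU finset.in_setX finset.setDv.
  by rewrite finset.in_set0 andbF orbF.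
rewrite [in X in _ = (X + _)%E]/escape subnn mul0r oppr0 expR0 mulr1.
rewrite [X in (_ + X)%E = _](_ : _ = (\sum_(X in powerset B | X != B) c * (theta A *
   escape leaf_rate #|B| #|X| first_rate * full leaf_rate #|X| first_rate))%:E); last first.
  rewrite -sumEFin; apply: eq_bigr => X /andP[/subB XB XneqB].
  rewrite IH//.
  - by rewrite thetaC//; congr EFin; ring.
  - by rewrite -ltnS; apply: leq_trans Bm; rewrite ltnS;
      apply: proper_card; rewrite finset.properEneq XneqB.
  - exact: fintype.subset_trans BO.
  - rewrite disjoint_sym disjoint_setU ![[disjoint block X X & _]]disjoint_sym.
    apply/andP; split.
      apply: disjointWr AB; apply/fintype.subsetP => -[s j].
      rewrite !finset.in_setX => /andP[sX jX]; apply/andP; split.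
        by apply: fintype.subsetP sX; exact: sources_mono.
      exact: fintype.subsetP jX.
    rewrite -setI_eq0; apply/eqP/finset.setP => -[s j].
    rewrite finset.in_setI !finset.in_setX finset.in_setD finset.in_set0.
    by case: (j \in X); rewrite ?andbF.
rewrite [X in c * (X)]mulrC.
(* The terms with [X != B] are the same finite number on both sides and cancel; an infinite
   expectation would contradict the finite total. *)
case: (expect p lambda _) => [y||] //= [/addIr ->].
by [].
Qed.

Lemma card_other_leaves : #|other_leaves d| = d.-1.
Proof.
pose v1 : 'I_d := Ordinal (ltnW d2).
rewrite -[in RHS](card_ord d) -(cardC1 v1); apply: fintype.eq_card => i.
by rewrite !inE /is_v1 -val_eqE.
Qed.

Lemma expect_U (g : nat -> R) : (forall k, 0 <= g k) ->
  E_ (fun w : outcome d => g (U w)) = (\sum_(k < d) 'C(d.-1, k)%:R *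
    escape leaf_rate d.-1 k first_rate * full leaf_rate k first_rate * g k)%:E.
Proof.
move=> g0; set O := other_leaves d.
have splitU (w : outcome d) : g (U w) = \sum_(B in powerset O)
    g #|B| * ((reach B (edges w) == B) && [disjoint edges w & block B (O :\: B)])%:R.
  rewrite (bigD1 (reach O (edges w))) ?powersetE ?reach_sub//= big1 => [|B].
    by rewrite addr0 -reach_eq ?reach_sub// eqxx mulr1 U_reach.
  rewrite powersetE => /andP[BO BN]; rewrite -reach_eq//.
  by rewrite eq_sym (negbTE BN) mulr0.
under [X in expect p lambda X]eq_fun do rewrite splitU.
rewrite expect_sum => [|X w _]; last by rewrite mulr_ge0.
transitivity (\sum_(B in powerset O) g #|B| * (full leaf_rate #|B| first_rate *
    escape leaf_rate #|O| #|B| first_rate))%:E.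
  rewrite -sumEFin; apply: eq_bigr => B; rewrite powersetE => BO.
  have dis : [disjoint B & (O :\: B)%SET].
    by rewrite -setI_eq0 finset.setIDA finset.setDIl finset.setDv finset.set0I.
  rewrite expect_reach//; last first.
    rewrite -setI_eq0; apply/eqP/finset.setP => -[s j].
    rewrite finset.in_setI !finset.in_setX finset.in_setD finset.in_set0.
    by case: (j \in B); rewrite ?andbF.
  rewrite theta_block// ?finset.subsetDl//.
  by rewrite /escape cardsD (finset.setIidPr BO).
rewrite (sum_powerset_card O (fun k => g k * (full leaf_rate k first_rate *
  escape leaf_rate #|O| k first_rate))) card_other_leaves prednK ?(ltnW d2)//.
by congr EFin; apply: eq_bigr => k _; rewrite -mulr_natr; ring.
Qed.

End LawOfU.

(** * The expectation in [M] in terms of the generating function *)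

Section Value.
Variable R : realType.
Implicit Types (n : nat) (p r : R).

(** This is [p_hat p / (1 - p_hat p)], so that [r * odds_ratio p = lambda * p_hat p] when
    [r = lambda * (1 - p_hat p)]. *)
Definition odds_ratio p : R := p / (1 - 2 * p).

(** With [d = n.+1], the mean number of particles sent from the centre to the [n] leaves other than
    [v_1]. *)
Definition centre_rate n p : R := n%:R * (1 - p_star n.+1 p) / n.+1%:R.

(* The expectation in the definition of [M], as a function of the rate
   [r = lambda * (1 - p_hat p)] at which a visited leaf sends particles to the
   other leaves. *)
Definition value n p r : R :=
  expR (r - p_star n.+1 p) *
  epgf (r / n%:R) n (expR (- (r * odds_ratio p))) ((centre_rate n p + r) / n%:R).

Lemma expect_value n p lambda : (0 < n)%N -> 0 < p -> p < 2^-1 -> 0 <= lambda ->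
  expect p lambda (fun w : outcome n.+1 => expR (lambda - p_star n.+1 p -
    p_hat p * (1 + (U w)%:R) * lambda)) = (value n p (lambda * (1 - p_hat p)))%:E.
Proof.
move=> n0 p0 p12 l0.
pose g k := expR (lambda - p_star n.+1 p - p_hat p * (1 + k%:R) * lambda).
have := expect_U p0 p12 (n0 : (2 <= n.+1)%N) l0 (g := g) (fun k => expR_ge0 _).
move=> ->; congr EFin.
have n0R : n%:R != 0 :> R by rewrite pnatr_eq0 -lt0n.
have p1 : 1 - p != 0 by apply/eqP; move: p12; lra.
have p2 : 1 - 2 * p != 0 by apply/eqP; move: p12; lra.
have lr : leaf_rate n.+1 p lambda = lambda * (1 - p_hat p) / n%:R.
  by rewrite /leaf_rate -natr1 addrK mulrA.
have fr : first_rate n.+1 p lambda =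
    (centre_rate n p + lambda * (1 - p_hat p)) / n%:R.
  rewrite /first_rate lr /centre_rate [RHS]mulrDl; congr (_ + _).
  by field; rewrite n0R addrC natr1 pnatr_eq0.
rewrite fr lr /value /epgf /gpart mulr_sumr; apply: eq_bigr => k _.
rewrite -[_ ^+ k]expRM_natl /g.
rewrite [X in _ * X = _](_ : _ = expR (lambda * (1 - p_hat p) - p_star n.+1 p) *
  expR (k%:R * - (lambda * (1 - p_hat p) * odds_ratio p))); first by ring.
rewrite -expRD; congr expR.
have e1 : lambda * (1 - p_hat p) * odds_ratio p = lambda * p_hat p.
  by rewrite /odds_ratio /p_hat; field; rewrite p1 p2.
by rewrite e1; ring.
Qed.

Lemma p_hat_lt1 p : 0 < p -> p < 2^-1 -> p_hat p < 1.
Proof. by move=> ? ?; rewrite /p_hat ltr_pdivrMr; lra. Qed.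

(** Since [p_hat p < 1], the substitution [r = lambda * (1 - p_hat p)] is a bijection of the
    nonnegative reals; different [d] and [p] can then be compared at equal [r]. *)
Lemma M_value n p : (0 < n)%N -> 0 < p -> p < 2^-1 ->
  M n.+1 p = ereal_sup [set (value n p r)%:E | r in [set r : R | 0 <= r]]%classic.
Proof.
move=> n0 p0 p12; have ph := p_hat_lt1 p0 p12; congr ereal_sup.
apply/seteqP; split => [_ [l /= l0 <-]|_ [r /= r0 <-]].
  exists (l * (1 - p_hat p)); first by rewrite /= mulr_ge0// subr_ge0 ltW.
  by rewrite expect_value.
exists (r / (1 - p_hat p)); first by rewrite /= divr_ge0// subr_ge0 ltW.
have r'0 : 0 <= r / (1 - p_hat p) by rewrite divr_ge0// subr_ge0 ltW.
by rewrite expect_value// divfK// subr_eq0 gt_eqF.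
Qed.

End Value.

(** * Estimates for fixed d and p *)

Section Bounds.
Variable R : realType.
Implicit Types (n : nat) (p r : R).

Lemma p_starE n p : p_star n.+1 p = p * n%:R / (n%:R + 1 - (n%:R + 2) * p).
Proof.
rewrite /p_star -natr1 addrK; congr (_ / _); ring.
Qed.

Lemma p_star_den_gt0 n p : 0 < p -> p < 2^-1 -> (0 < n)%N ->
  0 < n%:R + 1 - (n%:R + 2) * p.
Proof.
move=> p0 p12 n0; have : 1 <= n%:R :> R by rewrite ler1n.
nra.
Qed.

Lemma centre_rateE n p : 0 < p -> p < 2^-1 -> (0 < n)%N ->
  centre_rate n p = n%:R * (1 - 2 * p) / (n%:R + 1 - (n%:R + 2) * p).
Proof.
move=> p0 p12 n0; have D0 := p_star_den_gt0 p0 p12 n0.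
rewrite /centre_rate p_starE -natr1; field.
by rewrite gt_eqF//= natr1 pnatr_eq0.
Qed.

Lemma centre_rate_mono n p p' : (0 < n)%N -> 0 < p' -> p' <= p -> p < 2^-1 ->
  centre_rate n p <= centre_rate n.+1 p'.
Proof.
move=> n0 p'0 pp' p12; have p0 := lt_le_trans p'0 pp'; have p'12 := le_lt_trans pp' p12.
have D0 := p_star_den_gt0 p0 p12 n0; have D'0 := p_star_den_gt0 p'0 p'12 (ltn0Sn n).
rewrite !centre_rateE// ler_pdivrMr// mulrAC ler_pdivlMr// -natr1.
have n1 : 1 <= n%:R :> R by rewrite ler1n.
rewrite -subr_ge0.
rewrite [leRHS](_ : _ = n%:R * (n%:R + 1) * (p - p') + (1 - 2 * p) * (1 - 2 * p')); last by field.
have : 0 <= n%:R * (n%:R + 1) * (p - p').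
  by rewrite !mulr_ge0 ?subr_ge0// addr_ge0.
have : 0 <= (1 - 2 * p) * (1 - 2 * p') by apply: mulr_ge0; lra.
lra.
Qed.

Lemma centre_rate_ge0 n p : 0 < p -> p < 2^-1 -> (0 < n)%N -> 0 <= centre_rate n p.
Proof.
move=> p0 p12 n0; rewrite centre_rateE// divr_ge0 ?(ltW (p_star_den_gt0 _ _ _))//.
by rewrite mulr_ge0//; lra.
Qed.

Lemma p_star_mono n p p' : (0 < n)%N -> 0 < p -> p <= p' -> p' < 2^-1 ->
  p_star n.+1 p <= p_star n.+1 p'.
Proof.
move=> n0 p0 pp' p'12; have p'0 := lt_le_trans p0 pp'; have p12 := le_lt_trans pp' p'12.
have D0 := p_star_den_gt0 p0 p12 n0; have D'0 := p_star_den_gt0 p'0 p'12 n0.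
rewrite !p_starE ler_pdivrMr// mulrAC ler_pdivlMr//.
rewrite -subr_ge0 [leRHS](_ : _ = n%:R * (n%:R + 1) * (p' - p)); last by ring.
by rewrite !mulr_ge0 ?subr_ge0// addr_ge0.
Qed.

Lemma p_star_ltS n p : (0 < n)%N -> 0 < p -> p < 2^-1 ->
  p_star n.+1 p < p_star n.+2 p.
Proof.
move=> n0 p0 p12.
have D0 := p_star_den_gt0 p0 p12 n0; have D'0 := p_star_den_gt0 p0 p12 (ltn0Sn n).
rewrite !p_starE ltr_pdivrMr// mulrAC ltr_pdivlMr// -natr1 -subr_gt0.
rewrite [ltRHS](_ : _ = p * (1 - 2 * p)); last by ring.
by rewrite mulr_gt0//; lra.
Qed.

Lemma odds_ratio_mono p p' : 0 < p -> p <= p' -> p' < 2^-1 ->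
  odds_ratio p <= odds_ratio p'.
Proof.
move=> p0 pp' p'12; rewrite /odds_ratio ler_pdivrMr; last by lra.
rewrite mulrAC ler_pdivlMr; lra.
Qed.

Lemma odds_ratio_ge0 p : 0 < p -> p < 2^-1 -> 0 <= odds_ratio p.
Proof. by move=> p0 p12; apply: divr_ge0; lra. Qed.

(** The additional leaf and the larger [centre_rate] lower the generating function. Lowering [p]
    multiplies its argument by some [y >= 1], which costs at most [y ^+ n.+1] because the final size
    is at most [n.+1]. *)
Lemma value_compare n p p' r : (0 < n)%N -> 0 < p' -> p' <= p -> p < 2^-1 -> 0 <= r ->
  value n.+1 p' r <= expR (p_star n.+1 p - p_star n.+2 p' +
    n.+1%:R * (r * (odds_ratio p - odds_ratio p'))) * value n p r.
Proof.
move=> n0 p'0 pp' p12 r0; have p0 := lt_le_trans p'0 pp'; have p'12 := le_lt_trans pp' p12.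
have k0 := odds_ratio_ge0 p0 p12.
set y := expR (r * (odds_ratio p - odds_ratio p')).
set x := expR (- (r * odds_ratio p)).
have y1 : 1 <= y by rewrite -expR0 ler_expR mulr_ge0// subr_ge0 odds_ratio_mono.
have x0 : 0 <= x := expR_ge0 _.
have x1 : x <= 1 by rewrite expR_le1 oppr_le0 mulr_ge0.
have xE : expR (- (r * odds_ratio p')) = y * x by rewrite -expRD; congr expR; ring.
have c0 := centre_rate_ge0 p0 p12 n0.
have cc := centre_rate_mono n0 p'0 pp' p12.
have b0 : 0 <= (centre_rate n.+1 p' + r) / n.+1%:R by rewrite divr_ge0// addr_ge0// (le_trans c0).
rewrite /value xE [X in X * _ <= _](_ : _ = expR (r - p_star n.+1 p) *
  expR (p_star n.+1 p - p_star n.+2 p')); last by rewrite -expRD; congr expR; ring.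
rewrite [X in _ <= X * _]expRD [X in _ <= _ * X * _]expRM_natl -/y -/x.
set E := epgf _ n x _.
suff : epgf (r / n.+1%:R) n.+1 (y * x) ((centre_rate n.+1 p' + r) / n.+1%:R) <= y ^+ n.+1 * E.
  move=> h; rewrite [leRHS](_ : _ = expR (r - p_star n.+1 p) *
    expR (p_star n.+1 p - p_star n.+2 p') * (y ^+ n.+1 * E)); last by ring.
  by rewrite ler_wpM2l// mulr_ge0 ?expR_ge0.
apply: le_trans (epgf_scale (divr_ge0 r0 (ler0n _ _)) x0 n.+1 b0 y1) _.
rewrite ler_wpM2l ?exprn_ge0 ?(le_trans ler01 y1)//.
apply: le_trans (epgf_compare x0 x1 r0 n0 (leqnn n) (addr_ge0 c0 r0)).
apply: epgf_nincr => //; rewrite ?divr_ge0 ?addr_ge0//.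
by rewrite ler_wpM2r ?invr_ge0// lerD2r.
Qed.

(** In the term [k = 0] the factor [expR r] cancels and [expR (- (p_star + centre_rate))] remains.
    Each term [k >= 1] is at most ['C(n, k) * expR (- (r * (odds_ratio p - 1 / n)))]. *)
Lemma value_tail n p r : (0 < n)%N -> 0 < p -> p < 2^-1 -> 0 <= r ->
  n%:R^-1 <= odds_ratio p ->
  value n p r <= expR (- 2^-1) + 2 ^+ n * expR (- (r * (odds_ratio p - n%:R^-1))).
Proof.
move=> n0 p0 p12 r0 k1; have D0 := p_star_den_gt0 p0 p12 n0.
have n0R : 0 < n%:R :> R by rewrite ltr0n.
have n1R : 1 <= n%:R :> R by rewrite ler1n.
have c0 := centre_rate_ge0 p0 p12 n0.
have ps0 := p_star_ge0 p0 p12 (n0 : 2 <= n.+1)%N.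
have rho0 : 0 <= r / n%:R by rewrite divr_ge0.
have b0 : 0 <= (centre_rate n p + r) / n%:R by rewrite divr_ge0 ?addr_ge0.
rewrite /value; move: (odds_ratio p) k1 => kappa k1.
rewrite /epgf /gpart mulr_sumr big_ord_recl; apply: lerD.
  rewrite bin0 expr0 full_0 !mul1r mulr1 /escape /= subn0 mul0r addr0 -expRD ler_expR.
  rewrite [leLHS](_ : _ = - (p_star n.+1 p + centre_rate n p)); last by field; lra.
  rewrite lerN2 p_starE centre_rateE// -mulrDl ler_pdivlMr//.
  (* The inequality amounts to [(n - 2) * p <= n - 1]; only for [n = 1] is [n - 2] negative. *)
  have [->|n2] := eqVneq n 1%N; first by lra.
  have : 2 <= n%:R :> R by rewrite ler_nat; lia.
  by move: p0 p12; nra.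
rewrite [leRHS](_ : _ = \sum_(k < n.+1) 'C(n, k)%:R * expR (- (r * (kappa - n%:R^-1)))).
  rewrite [leRHS]big_ord_recl -[leLHS]add0r; apply: lerD; first by rewrite mulr_ge0 ?expR_ge0.
  apply: ler_sum => i _; rewrite mulrCA -!mulrA ler_wpM2l//.
  set k : nat := lift ord0 i.
  have k1' : 1 <= k%:R :> R by rewrite ler1n.
  have kn : (k <= n)%N by rewrite -ltnS ltn_ord.
  have knR : k%:R <= n%:R :> R by rewrite ler_nat.
  have f1 := full_le1 rho0 k b0; have f0 := full_ge0 rho0 k b0.
  rewrite -expRM_natl /escape natrB// !mulrA -!expRD.
  apply: le_trans (ler_piMr (expR_ge0 _) f1) _; rewrite ler_expR -subr_ge0.
  rewrite [leRHS](_ : _ = (n%:R - k%:R) / n%:R * centre_rate n p + p_star n.+1 p +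
    r * ((k%:R - 1) * (kappa - n%:R^-1) + k%:R * (n%:R - k%:R) / n%:R)).
    have nk : (0 : R) <= (n%:R - k%:R) / n%:R by rewrite divr_ge0// subr_ge0.
    rewrite addr_ge0 ?(addr_ge0 (mulr_ge0 nk c0))// mulr_ge0//.
    by rewrite -mulrA addr_ge0// mulr_ge0// subr_ge0.
  by field; lra.
rewrite -mulr_suml -[2]/(1 + 1 : R) addrC exprD1n; congr (_ * _).
by apply: eq_bigr => k _; rewrite expr1n.
Qed.

(** As the final size is at most [n], [value n p r] is at least [expR (r * (1 - n * odds_ratio p) -
    p_star)]. If [n * odds_ratio p < 1], this equals [1] at the rate [r] chosen below. *)
Lemma odds_ratio_ge_of_bounded n p : (0 < n)%N -> 0 < p -> p < 2^-1 ->
  (forall r, 0 <= r -> value n p r < 1) -> n%:R^-1 <= odds_ratio p.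
Proof.
move=> n0 p0 p12 v1; rewrite leNgt; apply/negP => k1.
have n0R : 0 < n%:R :> R by rewrite ltr0n.
have ps0 := p_star_ge0 p0 p12 (n0 : 2 <= n.+1)%N.
have k0 := odds_ratio_ge0 p0 p12.
have nk : 0 < 1 - n%:R * odds_ratio p.
  by rewrite subr_gt0 mulrC -ltr_pdivlMr// div1r.
have [r r0 rE] : exists2 r, 0 <= r & r * (1 - n%:R * odds_ratio p) = p_star n.+1 p.
  exists (p_star n.+1 p / (1 - n%:R * odds_ratio p)); first by rewrite divr_ge0// ltW.
  by rewrite divfK// gt_eqF.
have := v1 r r0; apply/negP; rewrite -leNgt /value.
have c0 := centre_rate_ge0 p0 p12 n0.
have x1 : expR (- (r * odds_ratio p)) <= 1 by rewrite expR_le1 oppr_le0 mulr_ge0.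
have b0 : 0 <= (centre_rate n p + r) / n%:R by rewrite divr_ge0 ?addr_ge0.
have rho0 : 0 <= r / n%:R by rewrite divr_ge0.
apply: le_trans (ler_wpM2l (expR_ge0 _) (epgf_ge_expn rho0 (expR_ge0 _) x1 n b0)).
rewrite -expRM_natl -expRD -[leLHS]expR0 ler_expR.
by rewrite -rE; lra.
Qed.

(** At [p = 9 / 19] the odds ratio is [9] and [p_star] is at least [9 / 11], with equality for
    [n = 1]. Separating final size [0] from the rest bounds [expR r] times the generating function
    by [1 + expR (- 8 * r)]. *)
Lemma value_lt1_near_half n r : (0 < n)%N -> 0 <= r ->
  value n (9%:R / 19%:R) r <= expR (- (9%:R / 11%:R)) * 2.
Proof.
move=> n0 r0; set p : R := 9%:R / 19%:R.
have p0 : 0 < p by rewrite divr_gt0.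
have p12 : p < 2^-1 by rewrite /p; lra.
have n0R : 0 < n%:R :> R by rewrite ltr0n.
have n1R : 1 <= n%:R :> R by rewrite ler1n.
have D0 := p_star_den_gt0 p0 p12 n0.
have c0 := centre_rate_ge0 p0 p12 n0.
have ps : 9%:R / 11%:R <= p_star n.+1 p.
  by rewrite p_starE ler_pdivlMr// /p; lra.
have kE : odds_ratio p = 9%:R by rewrite /odds_ratio /p; field; lra.
have b0 : 0 <= (centre_rate n p + r) / n%:R by rewrite divr_ge0 ?addr_ge0.
have rho0 : 0 <= r / n%:R by rewrite divr_ge0.
rewrite /value kE expRD mulrAC; set x := expR (- (r * 9%:R)).
have x0 : 0 <= x := expR_ge0 _.
have x1 : x <= 1 by rewrite expR_le1 oppr_le0 mulr_ge0.
have xr : x * expR r <= 1 by rewrite -expRD expR_le1; lra.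
rewrite mulrC; apply: ler_pM; rewrite ?expR_ge0 ?mulr_ge0 ?epgf_ge0 ?expR_ge0//.
  by rewrite ler_expR lerN2.
have tot := gpart_full (r / n%:R) n ((centre_rate n p + r) / n%:R).
have : epgf (r / n%:R) n x ((centre_rate n p + r) / n%:R) <=
    escape (r / n%:R) n 0 ((centre_rate n p + r) / n%:R) + x.
  rewrite /epgf /gpart big_ord_recl bin0 expr0 full_0 !mul1r mulr1 lerD2l.
  rewrite -[leRHS]mulr1 -[X in _ <= x * X]tot /gpart big_ord_recl mulrDr.
  rewrite -[leLHS]add0r; apply: lerD.
    by rewrite bin0 expr0 full_0 !mul1r mulr1 mulr_ge0 ?expR_ge0.
  rewrite mulr_sumr; apply: ler_sum => i _; rewrite expr1n mulr1 !mulrA.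
  rewrite ler_wpM2r ?full_ge0// ler_wpM2r ?expR_ge0// mulrC ler_wpM2r//.
  by rewrite /= /bump add1n exprS ler_piMr// exprn_ile1.
have : escape (r / n%:R) n 0 ((centre_rate n p + r) / n%:R) <= expR (- r).
  rewrite /escape ler_expR subn0 mul0r addr0 mulrCA divff ?gt_eqF// mulr1.
  by lra.
move=> e1 e2; have : expR r * epgf (r / n%:R) n x ((centre_rate n p + r) / n%:R) <=
   expR r * (expR (- r) + x).
  by rewrite ler_wpM2l ?expR_ge0//; apply: le_trans e2 _; rewrite lerD2r.
by rewrite mulrDr expRxMexpNx_1 [_ * x]mulrC => /le_trans; apply; lra.
Qed.

End Bounds.

(** * The thresholds [q] and their strict decrease *)

Section Threshold.
Variable R : realType.
Implicit Types (n d : nat) (p r : R).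

Lemma value_lt1 n p r : (0 < n)%N -> 0 < p -> p < 2^-1 -> (M n.+1 p < 1)%E ->
  0 <= r -> value n p r < 1.
Proof.
move=> n0 p0 p12; rewrite M_value// => M1 r0; rewrite -lte_fin.
by apply: le_lt_trans M1; apply: ereal_sup_ubound; exists r.
Qed.

Lemma M_le n p (a : R) : (0 < n)%N -> 0 < p -> p < 2^-1 ->
  (forall r, 0 <= r -> value n p r <= a) -> (M n.+1 p <= a%:E)%E.
Proof.
move=> n0 p0 p12 h; rewrite M_value//; apply: ge_ereal_sup => _ [r /= r0 <-].
by rewrite lee_fin h.
Qed.

Lemma q_lt_pinfty n : (0 < n)%N -> (q R n.+1 < +oo)%E.
Proof.
move=> n0; apply: (@le_lt_trans _ _ (9%:R / 19%:R)%:E); last exact: ltry.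
apply: ereal_inf_lbound; exists (9%:R / 19%:R) => //=.
have p0 : 0 < 9%:R / 19%:R :> R by rewrite divr_gt0.
have p12 : 9%:R / 19%:R < 2^-1 :> R by lra.
split; first by rewrite p0 p12.
apply: le_lt_trans (M_le n0 p0 p12 (fun r => value_lt1_near_half n0)) _.
rewrite lte_fin expRN mulrC ltr_pdivrMr ?expR_gt0// mul1r.
(* The exponent is cut in three because [1 + 9 / 11 < 2], whereas [(1 + 3 / 11) ^ 3 > 2]. *)
rewrite [X in expR X](_ : _ = 3%:R * (3%:R / 11%:R)); last by field.
rewrite expRM_natl; apply: (@lt_le_trans _ _ ((1 + 3%:R / 11%:R) ^+ 3)); first by lra.
by rewrite lerXn2r ?nnegrE ?expR_ge0// ?expR_ge1Dx//; lra.
Qed.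

Lemma odds_ratio_continuous p : p < 2^-1 -> {for p, continuous (@odds_ratio R)}.
Proof.
move=> p12; apply: cvgM; first exact: cvg_id.
apply: cvgV; first by rewrite gt_eqF//; lra.
apply: cvgB; first exact: cvg_cst.
by apply: cvgM; [exact: cvg_cst|exact: cvg_id].
Qed.

Lemma p_star_continuous n p : (0 < n)%N -> 0 < p -> p < 2^-1 ->
  {for p, continuous (@p_star R n.+1)}.
Proof.
move=> n0 p0 p12; have D0 := p_star_den_gt0 p0 p12 n0.
have -> : @p_star R n.+1 = fun p => p * n%:R / (n%:R + 1 - (n%:R + 2) * p).
  by apply/funext => x; rewrite p_starE.
apply: cvgM; first by apply: cvgM; [exact: cvg_id|exact: cvg_cst].
apply: cvgV; first by rewrite gt_eqF.
apply: cvgB; first exact: cvg_cst.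
by apply: cvgM; [exact: cvg_cst|exact: cvg_id].
Qed.

(** Rates [r >= L] are handled by [value_tail], smaller ones by [value_compare]. The conditions
    involve only [a] and [b], so they can be arranged before [p] is known. *)
Lemma M_lt1_shift n (a b L s : R) : (0 < n)%N ->
  0 < a -> b < 2^-1 -> 0 <= L ->
  s = (2%:R * n%:R * n.+1%:R)^-1 ->
  expR (- 2^-1) + 2 ^+ n.+1 * expR (- (L * s)) < 1 ->
  odds_ratio b - odds_ratio a <= s ->
  p_star n.+1 b - p_star n.+2 a + n.+1%:R * (L * (odds_ratio b - odds_ratio a)) < 0 ->
  forall p, a <= p -> p <= b -> (M n.+1 p < 1)%E -> (M n.+2 a < 1)%E.
Proof.
move=> n0 a0 b12 L0 sE tail close neg p ap pb Mp.
have p0 := lt_le_trans a0 ap; have p12 := le_lt_trans pb b12.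
have a12 := le_lt_trans ap p12.
have n0R : 0 < n%:R :> R by rewrite ltr0n.
have kp := odds_ratio_ge_of_bounded n0 p0 p12 (fun r => value_lt1 n0 p0 p12 Mp).
have kpb := odds_ratio_mono p0 pb b12.
have kap := odds_ratio_mono a0 ap p12.
have ppb := p_star_mono n0 p0 pb b12.
(* [s] is half the gap between [1 / n] and [1 / (n + 1)]: one half is lost in passing from [p] to
   [a], the other is the decay rate of the tail. *)
have gap : n%:R^-1 - n.+1%:R^-1 = s + s.
  by rewrite sE -natr1; field; lra.
have ka : s <= odds_ratio a - n.+1%:R^-1.
  by move: gap kp kpb close; move: (n%:R^-1) (n.+1%:R^-1) => u v; lra.
have s0 : 0 < s by rewrite sE invr_gt0 !mulr_gt0.
set m := Num.max (expR (- 2^-1) + 2 ^+ n.+1 * expR (- (L * s)))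
  (expR (p_star n.+1 b - p_star n.+2 a + n.+1%:R * (L * (odds_ratio b - odds_ratio a)))).
apply: (@le_lt_trans _ _ m%:E); last by rewrite lte_fin gt_max tail expR_lt1.
apply: M_le => // r r0; rewrite le_max; apply/orP.
have [Lr|rL] := lerP L r; [left|right].
  apply: le_trans (value_tail _ a0 a12 r0 _) _ => //; first by rewrite -subr_ge0 (le_trans (ltW s0) ka).
  rewrite lerD2l ler_wpM2l ?exprn_ge0// ler_expR lerN2.
  by apply: ler_pM => //; apply: ltW.
apply: le_trans (value_compare n0 a0 ap p12 r0) _.
rewrite -[leRHS]mulr1; apply: ler_pM; rewrite ?expR_ge0//.
- by rewrite mulr_ge0 ?expR_ge0 ?epgf_ge0 ?expR_ge0 ?divr_ge0 ?addr_ge0 ?centre_rate_ge0.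
- rewrite ler_expR lerD ?lerB// ler_wpM2l//.
  by apply: ler_pM; rewrite ?subr_ge0 ?(ltW rL)//; lra.
- exact/ltW/value_lt1.
Qed.
End Threshold.

Theorem theorem3 (R : realType) (d : nat) (hd : (2 <= d)%N) :
  (q R d.+1 < q R d)%E.
Proof.
case: d hd => [//|[//|d]] _; set n := d.+1; have n0 : (0 < n)%N by [].
have qS := q_lt_pinfty R (ltn0Sn n).
have [-> //|qd] := eqVneq (q R n.+1) +oo%E.
have n0R : 0 < n%:R :> R by rewrite ltr0n.
have [p1 [/andP[p10 p112] Mp1]] : exists p : R, 0 < p < 2^-1 /\ (M n.+1 p < 1)%E.
  apply: contrapT => noP; move/eqP: qd; apply; rewrite /q -[RHS]ereal_inf0.
  congr ereal_inf; apply/seteqP; split => // x [p Sp px].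
  by case: noP; exists p.
(* The bound [1 / n <= p / (1 - 2 * p)] reads [p >= 1 / (n + 2)]. It keeps the infimum away from
   [0], leaving room for a smaller parameter. *)
have p_ge p : 0 < p < 2^-1 /\ (M n.+1 p < 1)%E -> (n%:R + 2)^-1 <= p.
  move=> [/andP[p0 p12] Mp].
  have := odds_ratio_ge_of_bounded n0 p0 p12 (fun r => value_lt1 n0 p0 p12 Mp).
  rewrite /odds_ratio ler_pdivlMr ?subr_gt0; last by lra.
  rewrite mulrC ler_pdivrMr// => h.
  by rewrite -[_^-1]mul1r ler_pdivrMr ?addr_gt0//; lra.
have q_fin : q R n.+1 \is a fin_num.
  rewrite fin_numE qd andbT -ltNye; apply: (@lt_le_trans _ _ (n%:R + 2)^-1%:E).
    exact: ltNyr.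
  by apply: le_ereal_inf_tmp => _ [p Sp <-]; rewrite lee_fin p_ge.
pose Q := fine (q R n.+1).
have qE : q R n.+1 = Q%:E by rewrite fineK.
have Q_ge : (n%:R + 2)^-1 <= Q.
  rewrite -lee_fin -qE; apply: le_ereal_inf_tmp => _ [p Sp <-].
  by rewrite lee_fin p_ge.
have Q0 : 0 < Q by apply: lt_le_trans Q_ge; rewrite invr_gt0 addr_gt0.
have Q12 : Q < 2^-1.
  apply: (le_lt_trans _ p112); rewrite -lee_fin -qE.
  by apply: ereal_inf_lbound; exists p1 => //=; rewrite p10 p112.
pose s : R := (2%:R * n%:R * n.+1%:R)^-1.
have s0 : 0 < s by rewrite invr_gt0 !mulr_gt0.
have [L L0 tail] : exists2 L, 0 <= L & expR (- 2^-1) + 2 ^+ n.+1 * expR (- (L * s)) < 1.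
  have e1 : 0 < 1 - expR (- 2^-1) :> R by rewrite subr_gt0 expR_lt1 oppr_lt0 invr_gt0.
  (* [t] is chosen so that [expR t >= 1 + t] suffices for the tail bound, with [L * s = t]. *)
  pose t := 2 ^+ n.+1 / (1 - expR (- 2^-1)) : R.
  have t0 : 0 < t by rewrite divr_gt0 ?exprn_gt0.
  exists (t / s); first by rewrite ltW ?divr_gt0.
  rewrite divfK ?gt_eqF// addrC -ltrBrDr expRN ltr_pdivrMr ?expR_gt0//.
  rewrite mulrC -ltr_pdivrMr//; apply: lt_le_trans (expR_ge1Dx t).
  by rewrite -/t ltrDr.
have cvp : ((fun e : R => Q + e) @ 0^'+ --> Q)%classic.
  rewrite -[X in (_ --> X)%classic]addr0; apply: cvgD; first exact: cvg_cst.
  by apply: cvg_at_right_filter; exact: cvg_id.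
have cvm : ((fun e : R => Q - e) @ 0^'+ --> Q)%classic.
  rewrite -[X in (_ --> X)%classic]subr0; apply: cvgB; first exact: cvg_cst.
  by apply: cvg_at_right_filter; exact: cvg_id.
have cvk : ((fun e : R => odds_ratio (Q + e) - odds_ratio (Q - e)) @ 0^'+ --> (0 : R))%classic.
  rewrite -[X in (_ --> X)%classic](subrr (odds_ratio Q)); apply: cvgB.
    exact: (cvg_comp _ _ cvp (odds_ratio_continuous Q12)).
  exact: (cvg_comp _ _ cvm (odds_ratio_continuous Q12)).
(* [L] is fixed before [e], so the term containing it tends to [0]; the limit is negative by
   [p_star_ltS]. *)
have cvn : ((fun e : R => p_star n.+1 (Q + e) - p_star n.+2 (Q - e) +
    n.+1%:R * (L * (odds_ratio (Q + e) - odds_ratio (Q - e)))) @ 0^'+ -->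
    p_star n.+1 Q - p_star n.+2 Q)%classic.
  rewrite -[X in (_ --> X)%classic]addr0; apply: cvgD.
    apply: cvgB.
      exact: (cvg_comp _ _ cvp (p_star_continuous n0 Q0 Q12)).
    exact: (cvg_comp _ _ cvm (p_star_continuous (ltn0Sn n) Q0 Q12)).
  rewrite -[X in (_ --> X)%classic](mulr0 n.+1%:R); apply: cvgM; first exact: cvg_cst.
  rewrite -[X in (_ --> X)%classic](mulr0 L).
  by apply: cvgM => //; exact: cvg_cst.
near (0 : R)^'+%classic => e.
have e0 : 0 < e by near: e; exact: nbhs_right_gt.
(* A [p] just above the infimum [Q] is enough to place [Q - e] in the set defining the next
   threshold. *)
have [p [/andP[p0 p12] Mp] pQ] :
    exists2 p : R, 0 < p < 2^-1 /\ (M n.+1 p < 1)%E & p < Q + e.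
  have [_ [p Sp <-]] := lb_ereal_inf_adherent e0 q_fin.
  by rewrite -/(q R n.+1) qE lte_fin => ?; exists p.
rewrite qE; apply: (@le_lt_trans _ _ (Q - e)%:E); last by rewrite lte_fin ltrBlDr ltrDl.
have eQ : 0 < Q - e by rewrite subr_gt0; near: e; exact: nbhs_right_lt.
apply: ereal_inf_lbound; exists (Q - e) => //=; split.
  by rewrite eQ (lt_trans _ Q12)// ltrBlDr ltrDl.
have Qp : Q <= p.
  by rewrite -lee_fin -qE; apply: ereal_inf_lbound; exists p => //=; rewrite p0 p12.
apply: (@M_lt1_shift _ n (Q - e) (Q + e) L s n0 eQ _ L0 erefl tail _ _ p) => //.
- rewrite -ltrBrDl; near: e; apply: nbhs_right_lt; rewrite subr_gt0//.
- apply: ltW; near: e; exact: (cvgr_lt _ cvk).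
- near: e; apply: (cvgr_lt _ cvn); rewrite subr_lt0; exact: p_star_ltS.
- by apply: le_trans Qp; rewrite gerBl ltW.
- exact: ltW.
Unshelve. all: by end_near. Qed.
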